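(* Let $\mathcal{D}=(V,E,F)$ be an infinite cellular decomposition of a non-compact surface $S$. Let $R$ denote the set of all functions $r\in(0,\infty)^{V\times[0,\infty)}$ whose discrete Gaussian curvatures $K_i(r(t))$ are uniformly bounded on $V\times[0,\infty)$. In both hyperbolic and Euclidean background geometries, let $\delta>0$ be an arbitrarily small constant. If $\Theta\in(\delta,\pi-\delta)^E$ satisfies condition (C1) (see context), then for any initial value $r(0)\in(0,\infty)^V$ with bounded discrete Gaussian curvature, the combinatorial Ricci flow $$\frac{\mathrm{d}r_i}{\mathrm{d}t}=-K_i\,s(r_i),\qquad\forall v_i\in V,$$ with initial value $r(0)$ admits a unique solution $r\in R$. Here $s(r_i)=r_i$ in Euclidean background geometry and $s(r_i)=\sinh r_i$ in hyperbolic background geometry.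
   Context: $V,E,F$ are the vertices, edges and faces of $\mathcal{D}$; $j\sim i$ means $v_i,v_j$ are joined by an edge $[v_i,v_j]\in E$; the degree $d_i$ (number of edges at $v_i$) is finite; the 1-skeleton $(V,E)$ is assumed connected (graph distance between any two vertices is finite). $\Theta_{ij}=\Theta([v_i,v_j])$ is the intersection angle. Condition (C1): if edges $e_1,\dots,e_m$ form the boundary of a face, then $\sum_{l=1}^m\Theta(e_l)=(m-2)\pi$. A circle packing metric is a function $r:V\to(0,\infty)$, $r_i=r(v_i)$. For an edge $[v_i,v_j]$, consider the triangle $v_iv_jv_f$ in the Euclidean (resp. hyperbolic) plane with $|v_iv_f|=r_i$, $|v_jv_f|=r_j$ and $|v_iv_j|=l_{ij}$, where $l_{ij}=\sqrt{r_i^2+r_j^2+2r_ir_j\cos\Theta_{ij}}$ (resp. $l_{ij}=\cosh^{-1}(\cosh r_i\cosh r_j+\sinh r_i\sinh r_j\cos\Theta_{ij})$); the angle at $v_f$ is $\pi-\Theta_{ij}$. Let $\theta_{ij}$ be the inner angle at $v_i$. The discrete Gaussian (vertex) curvature is $2\pi$ minus the total cone angle at $v_i$, i.e. $K_i(r)=2\pi-2\sum_{j\sim i}\theta_{ij}(r_i,r_j)$. *)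

(* Defs.v *)
From mathcomp Require Import all_boot all_order all_algebra.
From mathcomp Require Import all_classical all_reals all_analysis.

Set Implicit Arguments.
Unset Strict Implicit.
Unset Printing Implicit Defensive.

Import Order.TTheory GRing.Theory Num.Theory.
Import numFieldNormedType.Exports.

Local Open Scope classical_set_scope.
Local Open Scope ring_scope.

Definition homeomorphic_sets (X Y : topologicalType) (A : set X) (B : set Y) :=
  exists (f : X -> Y) (g : Y -> X),
    [/\ set_fun A B f, set_fun B A g,
        (forall x, A x -> g (f x) = x) /\ (forall y, B y -> f (g y) = y),
        {within A, continuous f} & {within B, continuous g}].

Definition surface (R : realType) (S : topologicalType) : Prop :=
  [/\ hausdorff_space S, @second_countable S &
      forall x : S, exists (U : set S) (O : set (R * R)%type),
        [/\ open U, U x, open O & homeomorphic_sets U O]].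

Definition noncompact (S : topologicalType) : Prop := ~ compact [set: S].

Definition closed_disc (R : realType) : set (R * R)%type :=
  [set p | p.1 ^+ 2 + p.2 ^+ 2 <= 1].

Definition open_disc (R : realType) : set (R * R)%type :=
  [set p | p.1 ^+ 2 + p.2 ^+ 2 < 1].

(* Point at parameter t in [0, 1] of the k-th of m equal arcs of the circle. *)
Definition arc_point (R : realType) (m k : nat) (t : R) : (R * R)%type :=
  let a := 2 * pi * (k%:R + t) / m%:R in (cos a, sin a).

(* A cell structure on S whose 2-cells are polygons.  Edges and faces are given
   by characteristic maps on [0, 1] and on the closed disc; only the values of
   these maps there are relevant.  Loops, multiple edges and polygons with
   identified sides are allowed.  A pair (e, b) : E * bool is the edge e
   oriented from edge_end e b to edge_end e (~~ b); face_boundary lists the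
   oriented edges met by the attaching map along the circle. *)
Record cellular_decomposition
    (R : realType) (S : topologicalType) (V E F : choiceType) := {
  vertex_point : V -> S;
  edge_end : E -> bool -> V;
  edge_map : E -> R -> S;
  face_boundary : F -> seq (E * bool);
  face_map : F -> (R * R)%type -> S;
  edge_map0 : forall e, edge_map e 0 = vertex_point (edge_end e false);
  edge_map1 : forall e, edge_map e 1 = vertex_point (edge_end e true);
  edge_map_continuous : forall e, {within `[0, 1], continuous (edge_map e)};
  face_map_continuous :
    forall f, {within @closed_disc R, continuous (face_map f)};
  face_boundary_neq0 : forall f, face_boundary f != [::];
  face_boundary_map : forall f k e b, onth (face_boundary f) k = Some (e, b) ->
    forall t : R, 0 <= t <= 1 ->
    face_map f (arc_point (size (face_boundary f)) k t) =
    edge_map e (if b then 1 - t else t);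
  open_cell : V + E + F -> set S := fun c =>
    match c with
    | inl (inl v) => [set vertex_point v]
    | inl (inr e) => edge_map e @` `]0, 1[
    | inr f => face_map f @` @open_disc R
    end;
  edge_map_inj : forall e, set_inj `]0, 1[ (edge_map e);
  face_map_inj : forall f, set_inj (@open_disc R) (face_map f);
  open_cells_disjoint : trivIset setT open_cell;
  open_cells_cover : \bigcup_c open_cell c = [set: S];
  weak_topology : forall A : set S,
    (forall e, closed (`[0, 1] `&` edge_map e @^-1` A)) ->
    (forall f, closed (@closed_disc R `&` face_map f @^-1` A)) ->
    closed A
}.

Definition infinite_decomposition (R : realType) (S : topologicalType)
    (V E F : choiceType) (D : cellular_decomposition R S V E F) : Prop :=
  infinite_set [set: V + E + F].

(* Oriented edges leaving v; a loop at v contributes both orientations. *)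
Definition out_edges (R : realType) (S : topologicalType)
    (V E F : choiceType) (D : cellular_decomposition R S V E F) (v : V) :
    set (E * bool) :=
  [set d | edge_end D d.1 d.2 = v].

Definition finite_degrees (R : realType) (S : topologicalType)
    (V E F : choiceType) (D : cellular_decomposition R S V E F) : Prop :=
  forall v, finite_set (out_edges D v).

Definition adjacent (R : realType) (S : topologicalType)
    (V E F : choiceType) (D : cellular_decomposition R S V E F) (v w : V) :
    Prop :=
  exists e b, edge_end D e b = v /\ edge_end D e (~~ b) = w.

Definition connected_skeleton (R : realType) (S : topologicalType)
    (V E F : choiceType) (D : cellular_decomposition R S V E F) : Prop :=
  forall v w, exists p : seq V,
    path (fun x y => `[< adjacent D x y >]) v p /\ last v p = w.

Definition condition_C1 (R : realType) (S : topologicalType)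
    (V E F : choiceType) (D : cellular_decomposition R S V E F)
    (Theta : E -> R) : Prop :=
  forall f, \sum_(d <- face_boundary D f) Theta d.1 =
            ((size (face_boundary D f))%:R - 2) * pi.

Definition sinh (R : realType) (x : R) : R := (expR x - expR (- x)) / 2.
Definition cosh (R : realType) (x : R) : R := (expR x + expR (- x)) / 2.
(* Inverse of cosh on [0, +oo[, meant for arguments >= 1. *)
Definition acosh (R : realType) (x : R) : R := ln (x + Num.sqrt (x ^+ 2 - 1)).

Inductive geometry := Euclidean | Hyperbolic.

Definition edge_length (R : realType) (g : geometry) (Theta ri rj : R) : R :=
  match g with
  | Euclidean => Num.sqrt (ri ^+ 2 + rj ^+ 2 + 2 * ri * rj * cos Theta)
  | Hyperbolic => acosh (cosh ri * cosh rj + sinh ri * sinh rj * cos Theta)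
  end.

(* Angle, between sides of lengths a and b and opposite to a side of length c,
   of a triangle in the background geometry (law of cosines). *)
Definition triangle_angle (R : realType) (g : geometry) (a b c : R) : R :=
  match g with
  | Euclidean => acos ((a ^+ 2 + b ^+ 2 - c ^+ 2) / (2 * a * b))
  | Hyperbolic =>
      acos ((cosh a * cosh b - cosh c) / (sinh a * sinh b))
  end.

Definition inner_angle (R : realType) (g : geometry) (Theta ri rj : R) : R :=
  triangle_angle g ri (edge_length g Theta ri rj) rj.

(* The sum runs over the edge ends at v, so that the cone angle is the total
   one even in the presence of loops or multiple edges. *)
Definition curvature (R : realType) (S : topologicalType)
    (V E F : choiceType) (D : cellular_decomposition R S V E F)
    (g : geometry) (Theta : E -> R) (r : V -> R) (v : V) : R :=
  2 * pi - 2 * \sum_(d \in out_edges D v)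
                 inner_angle g (Theta d.1) (r v) (r (edge_end D d.1 (~~ d.2))).

Definition flow_scale (R : realType) (g : geometry) (x : R) : R :=
  match g with Euclidean => x | Hyperbolic => sinh x end.

(* Derivative of f at t as a function on [0, +oo[, hence one-sided at 0. *)
Definition has_halfline_derivative (R : realType) (f : R -> R) (t l : R) :
    Prop :=
  (fun h => h^-1 * (f (t + h) - f t)) @ within [set h | 0 <= t + h] 0^' --> l.

(* Time-dependent metrics are functions on all of R; only times t >= 0 matter. *)
Definition bounded_curvature_class (R : realType) (S : topologicalType)
    (V E F : choiceType) (D : cellular_decomposition R S V E F)
    (g : geometry) (Theta : E -> R) (r : V -> R -> R) : Prop :=
  (forall v t, 0 <= t -> 0 < r v t) /\
  exists M : R, forall v t, 0 <= t ->
    `|curvature D g Theta (r ^~ t) v| <= M.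

Definition ricci_flow_solution (R : realType) (S : topologicalType)
    (V E F : choiceType) (D : cellular_decomposition R S V E F)
    (g : geometry) (Theta : E -> R) (r0 : V -> R) (r : V -> R -> R) : Prop :=
  (forall v, r v 0 = r0 v) /\
  (forall v t, 0 <= t ->
    has_halfline_derivative (r v) t
      (- curvature D g Theta (r ^~ t) v * flow_scale g (r v t))).

(* Main.v *)
Require Import Defs.
From mathcomp Require Import all_boot all_order all_algebra.
From mathcomp Require Import all_classical all_reals all_analysis.
From mathcomp Require Import ring lra.
Import Order.TTheory GRing.Theory Num.Theory.
Import numFieldNormedType.Exports.
Local Open Scope classical_set_scope.
Local Open Scope ring_scope.

(** Pass to the coordinate x = - ln r (Euclidean) or x = - ln tanh (r / 2)
    (hyperbolic).  The flow becomes x' = K(x), and the angle at v_i of an edge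
    is the arc cotangent of
      (c(x_j) + c(x_i) cos Theta) / (s(x_i) sin Theta),
    where c, s are exp, exp in the Euclidean and cosh, sinh in the hyperbolic
    case.  This angle
    - decreases in x_j;
    - does not decrease when x_i and x_j grow by the same amount;
    - is Lipschitz in x_i, with a constant depending on Theta only;
    - satisfies |d angle / d x_j| <= angle / sin Theta.

    The vertex degrees are finite but unbounded, and in the hyperbolic case
    d K_i / d x_i is bounded at each vertex but not uniformly over the
    vertices, so the flow is not an ordinary differential equation with
    Lipschitz right-hand side in a space of bounded functions.  The first
    three properties replace that.  They say that L_i x_i + K_i(x) is monotone
    in all coordinates for some vertex-dependent L_i, and that adding a
    positive constant to x does not increase K.

    Existence ([quasimonotone_flow]).  Let Phi send a family of curves w to
    the solution f of f_i' + L_i f_i = L_i w_i + K_i(w) starting at x(0).  If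
    |K| <= M at time 0, then Phi preserves the families whose members are all
    M-Lipschitz in time, it is monotone, and these families form a complete
    lattice.  By the Knaster-Tarski argument Phi has a fixed point.  It solves
    the flow for all times, and being M-Lipschitz it has |K| <= M.  In the
    hyperbolic case the angles at v_i tend to 0 with x_i, uniformly in the
    neighbours, so K_i >= 0 for small x_i and x_i stays positive.

    Uniqueness ([sup_comparison], [flow_le]).  The difference z of two solutions
    of bounded curvature grows at most linearly, uniformly over the vertices.
    By the fourth property, K_i(x) - K_i(x') <= C sup z whenever z_i > 0, with
    C uniform: the sum over the edges at v_i is controlled by the total angle,
    that is by the curvature bound, and 1 / sin Theta by 1 / sin delta.  A
    Gronwall argument in the sup norm then gives z <= 0. *)

(** * Derivation rules for explicit functions *)

Section DerivativeRules.
Context {R : realType}.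
Implicit Types (f g : R -> R) (x a b : R).

Lemma der_eq f x a b : is_derive x 1 f a -> a = b -> is_derive x 1 f b.
Proof. by move=> ? <-. Qed.

Lemma der_const x a : is_derive x 1 (fun _ : R => a) 0.
Proof. exact: is_derive_cst. Qed.

Lemma der_id x : is_derive x 1 (fun t : R => t) 1.
Proof. exact: is_derive_id. Qed.

Lemma der_add f g x a b : is_derive x 1 f a -> is_derive x 1 g b ->
  is_derive x 1 (fun t => f t + g t) (a + b).
Proof. exact: is_deriveD. Qed.

Lemma der_opp f x a : is_derive x 1 f a -> is_derive x 1 (fun t => - f t) (- a).
Proof. exact: is_deriveN. Qed.

Lemma der_sub f g x a b : is_derive x 1 f a -> is_derive x 1 g b ->
  is_derive x 1 (fun t => f t - g t) (a - b).
Proof. exact: is_deriveB. Qed.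

Lemma der_mul f g x a b : is_derive x 1 f a -> is_derive x 1 g b ->
  is_derive x 1 (fun t => f t * g t) (a * g x + f x * b).
Proof.
move=> hf hg; have := is_deriveM hf hg.
by rewrite /GRing.scale /= => h; apply: is_derive_eq h _; rewrite addrC mulrC (mulrC (f x)).
Qed.

Lemma der_inv f x a : f x != 0 -> is_derive x 1 f a ->
  is_derive x 1 (fun t => (f t)^-1) (- a / f x ^+ 2).
Proof.
move=> f0 hf; have h := is_deriveV f0 hf; apply: is_derive_eq h _.
by rewrite /GRing.scale /= !mulNr mulrC.
Qed.

Lemma der_comp f g x a b : is_derive (g x) 1 f a -> is_derive x 1 g b ->
  is_derive x 1 (fun t => f (g t)) (a * b).
Proof. exact: is_derive1_comp. Qed.

Lemma is_derive_continuous f x a : is_derive x 1 f a -> {for x, continuous f}.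
Proof. by move=> h; apply/differentiable_continuous/derivable1_diffP. Qed.

Lemma der_exp f x a : is_derive x 1 f a ->
  is_derive x 1 (fun t => expR (f t)) (expR (f x) * a).
Proof. by apply: der_comp; exact: is_derive_expR. Qed.

Lemma der_atan f x a : is_derive x 1 f a ->
  is_derive x 1 (fun t => atan (f t)) (a / (1 + f x ^+ 2)).
Proof. by rewrite mulrC; apply: der_comp; exact: is_derive1_atan. Qed.

Lemma der_ln f x a : 0 < f x -> is_derive x 1 f a ->
  is_derive x 1 (fun t => ln (f t)) (a / f x).
Proof. by rewrite mulrC => f0; apply: der_comp; exact: is_derive1_ln. Qed.

End DerivativeRules.

(** Differentiates an explicit expression, taking the derivatives of unknown
    functions from the context; [derive_to] leaves the equation between the
    computed and the announced derivative. *)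
Ltac der := solve [repeat first
  [ eassumption | eapply der_const | eapply der_id | eapply der_sub | eapply der_add
  | eapply der_opp | eapply der_mul | eapply der_inv | eapply der_exp | eapply der_ln
  | eapply der_atan ]].

Ltac derive_to := eapply der_eq; [der | cbv beta delta [Datatypes.id]].

(** * Barriers and linear equations on the half-line *)

Section Barrier.
Context {R : realType}.
Implicit Types (f g : R -> R) (a b : R).

(** At the last time before t at which f <= m, the function would have to
    increase although f > m from there on: the mean value theorem forbids it.
    All comparisons between solutions below are instances. *)
Lemma barrier f (df : R -> R) (m : R) :
  f 0 <= m -> f x @[x --> 0^'+] --> f 0 ->
  (forall t : R, 0 < t -> is_derive t 1 f (df t)) ->
  (forall t : R, 0 < t -> m < f t -> df t <= 0) ->
  forall t : R, 0 <= t -> f t <= m.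
Proof.
move=> f0 cf0 dff df0 t t0; rewrite leNgt; apply/negP => mft.
have cf u : 0 < u -> {for u, continuous f}.
  by move=> /dff/is_derive_continuous.
pose A := [set u : R | 0 <= u <= t /\ f u <= m].
have A0 : A 0 by rewrite /A /= lexx t0.
have ubA : ubound A t by move=> u [/andP[]].
have hsA : has_sup A by split; [exists 0|exists t].
set s := sup A.
have s0 : 0 <= s by apply: ub_le_sup => //; exists t.
have st : s <= t by apply: ge_sup => //; exists 0.
have fs : f s <= m.
  rewrite leNgt; apply/negP => mfs.
  have sgt0 : 0 < s.
    rewrite lt_neqAle s0 andbT; apply/eqP => s0'.
    by move: mfs; rewrite -s0' ltNge f0.
  have /cvgrPdist_lt /(_ (f s - m)) := cf _ sgt0.
  rewrite subr_gt0 => /(_ mfs)/nbhs_ballP[e /= e0 be].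
  have [u Au su] := sup_adherent e0 hsA.
  have us : u <= s by apply: ub_le_sup => //; exists t.
  have : `|f s - f u| < f s - m.
    apply: be; rewrite /ball /= ger0_norm ?subr_ge0//.
    by rewrite ltrBlDr addrC -ltrBlDr.
  case: Au => _ fum; rewrite ltNge => /negP; apply.
  by rewrite (le_trans _ (ler_norm _))// lerB.
have st' : s < t.
  rewrite lt_neqAle st andbT; apply/eqP => E.
  by move: mft; rewrite -E ltNge fs.
have gts u : s < u -> u <= t -> m < f u.
  move=> su ut; rewrite ltNge; apply/negP => fum.
  suff : u <= s by rewrite leNgt su.
  apply: ub_le_sup; first by exists t.
  by split => //; rewrite ut (le_trans s0 (ltW su)).
have [c] : exists2 c, c \in `]s, t[%R & f t - f s = df c * (t - s).
  apply: MVT => //.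
    by move=> x; rewrite in_itv /= => /andP[sx _]; apply/dff/(le_lt_trans s0).
  apply/continuous_within_itvP => //; split.
  - move=> x; rewrite in_itv /= => /andP[sx _].
    by apply/cf/(le_lt_trans s0).
  - have [->//|sn] := eqVneq s 0.
    by apply: cvg_at_right_filter; apply: cf; rewrite lt_neqAle eq_sym sn.
  - by apply: cvg_at_left_filter; apply: cf; apply: le_lt_trans st'.
rewrite in_itv /= => /andP[sc ct] E.
have : f t - f s <= 0.
  rewrite E mulr_le0_ge0//; last by rewrite subr_ge0.
  by apply: df0; [exact: le_lt_trans sc|apply: gts => //; exact: ltW].
by rewrite subr_le0 leNgt (le_lt_trans fs mft).
Qed.

Lemma barrier_closed f (df : R -> R) (m : R) :
  f 0 <= m -> (forall t : R, 0 <= t -> is_derive t 1 f (df t)) ->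
  (forall t : R, 0 <= t -> m < f t -> df t <= 0) ->
  forall t : R, 0 <= t -> f t <= m.
Proof.
move=> f0 dff df0; apply: (@barrier f df) => //.
- by apply: cvg_at_right_filter; apply: is_derive_continuous (dff _ (lexx _)).
- by move=> t /ltW; exact: dff.
- by move=> t /ltW; exact: df0.
Qed.

(** Integrating from -1 makes 0 an interior point, so that the derivative at 0
    is two-sided. *)
Lemma antiderivative g : continuous g ->
  exists F : R -> R, forall t : R, 0 <= t -> is_derive t 1 F (g t).
Proof.
move=> cg.
exists (fun x => \int[@lebesgue_measure R]_(t in [set` `[-1, x]]) (g t))%R => t t0.
have [] := @continuous_FTC1_closed R g (-1) t (t + 1).
- by rewrite ltrDl.
- by apply: continuous_compact_integrable; [exact: segment_compact|exact: continuous_subspaceT].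
- by rewrite (lt_le_trans _ t0)// ltrN10.
- exact: cg.
move=> d e; rewrite -e derive1E; exact: derivableP.
Qed.

Lemma linear_ode g (L a : R) : continuous g ->
  exists f : R -> R, f 0 = a /\
    forall t : R, 0 <= t -> is_derive t 1 f (g t - L * f t).
Proof.
move=> cg.
have [F dF] : exists F : R -> R, forall t : R, 0 <= t ->
    is_derive t 1 F (expR (L * t) * g t).
  apply: antiderivative => t; apply: cvgM; last exact: cg.
  apply: continuous_comp; last exact: continuous_expR.
  by apply: cvgM; [exact: cvg_cst|exact: cvg_id].
exists (fun t => expR (- L * t) * (a + (F t - F 0))); split.
  by rewrite mulr0 expR0 subrr addr0 mul1r.
move=> t t0; have dFt := dF t t0.
derive_to.
rewrite mul0r add0r mulr1 add0r subr0 mulrA -expRD mulNr addNr expR0; ring.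
Qed.

End Barrier.

(** * Global solutions of quasimonotone systems *)

Section Existence.
Context {R : realType} {V : Type}.

(** Bounds on the velocity of a fixed point come from its Lipschitz constant
    through this. *)
Lemma derive_lip (f : R -> R) (M t k : R) : is_derive t 1 f k ->
  (forall h, 0 < h -> `|f (t + h) - f t| <= M * h) -> `|k| <= M.
Proof.
move=> dk lipf; rewrite leNgt; apply/negP => Mk.
have : (fun h : R => h^-1 *: (f (h *: 1 + t) - f t)) @ 0^' --> k.
  by case: dk => + <-.
move=> /cvgrPdist_lt /(_ (`|k| - M)); rewrite subr_gt0 => /(_ Mk).
rewrite near_withinE => /nbhs_ballP[e /= e0 be].
have e20 : 0 < e / 2 by rewrite divr_gt0.
have := be (e / 2); rewrite /ball /= sub0r normrN gtr0_norm//.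
rewrite ltr_pdivrMr// ltr_pMr// ltr1n => /(_ isT (lt0r_neq0 e20)).
have := lipf _ e20; rewrite [e / 2 *: 1]mulr1 (addrC _ t) => h.
rewrite ltNge => /negP; apply; rewrite lerBlDr.
have E : `|(e / 2)^-1 *: (f (t + e / 2) - f t)| <= M.
  by rewrite normrM gtr0_norm ?invr_gt0// mulrC ler_pdivrMr.
rewrite (le_trans _ (lerD (lexx _) E))//.
by rewrite (le_trans _ (ler_normD _ _))// subrK.
Qed.

Context (K : V -> (V -> R) -> R) (L : V -> R) (x0 : V -> R) (M : R).
Hypothesis L0 : forall i, 0 <= L i.
Hypothesis monoK : forall i (w w' : V -> R), (forall j, w j <= w' j) ->
  L i * w i + K i w <= L i * w' i + K i w'.
Hypothesis shiftK : forall i (w : V -> R) (c : R), 0 <= c ->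
  K i (fun j => w j + c) <= K i w.
Hypothesis boundK : forall i, `|K i x0| <= M.

Definition is_lip_curve (w : V -> R -> R) :=
  (forall i, w i 0 = x0 i) /\
  forall i (s t : R), 0 <= s -> s <= t -> `|w i t - w i s| <= M * (t - s).

(** A fixed point of the response to this source solves x_i' = K_i(x), while the
    source is monotone in w, which K_i is not. *)
Definition source (w : V -> R -> R) i (t : R) := L i * w i t + K i (w ^~ t).

(** The Lipschitz estimate in the sup norm: monotonicity and the shift inequality
    together bound the increment by L_i c, whatever the number of coordinates
    on which K_i depends. *)
Lemma source_le i (w w' : V -> R) (c : R) : 0 <= c -> (forall j, w j <= w' j + c) ->
  L i * w i + K i w <= L i * w' i + K i w' + L i * c.
Proof.
move=> c0 h; apply: le_trans (monoK i _ _ h) _.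
have := shiftK i w' c c0; lra.
Qed.

Lemma speed_ge0 : V -> 0 <= M.
Proof. by move=> i; apply: le_trans (boundK i). Qed.

Lemma source_lip w : is_lip_curve w -> forall i (s t : R), 0 <= s -> s <= t ->
  `|source w i t - source w i s| <= L i * (M * (t - s)).
Proof.
move=> [_ lw] i s t s0 st.
have c0 : 0 <= M * (t - s) by rewrite mulr_ge0 ?subr_ge0 ?speed_ge0.
have := @source_le i (w ^~ t) (w ^~ s) _ c0.
have := @source_le i (w ^~ s) (w ^~ t) _ c0.
rewrite /source ler_norml => h1 h2.
have {}h1 := h1 (fun j => _); have {}h2 := h2 (fun j => _).
have /h1 {}h1 : forall j, w j s <= w j t + M * (t - s).
  by move=> j; have := lw j s t s0 st; rewrite ler_norml; lra.
have /h2 {}h2 : forall j, w j t <= w j s + M * (t - s).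
  by move=> j; have := lw j s t s0 st; rewrite ler_norml; lra.
by apply/andP; split; lra.
Qed.

Definition is_response w i (f : R -> R) := f 0 = x0 i /\
  forall t : R, 0 <= t -> is_derive t 1 f (source w i t - L i * f t).

Definition response w i : R -> R := xget (fun=> 0) (is_response w i).

(** The source is only meaningful at nonnegative times; it is held
    constant before 0, so that the linear equation has a continuous
    right-hand side. *)
Lemma responseP w i : is_lip_curve w -> is_response w i (response w i).
Proof.
move=> lw; apply: xgetPex.
have cg : continuous (fun t : R => source w i (Num.max t 0)).
  move=> t; apply/cvgrPdist_lt => e e0.
  set C := L i * M.
  have C0 : 0 <= C by rewrite mulr_ge0// speed_ge0.
  have lipg (a b : R) : `|source w i (Num.max a 0) - source w i (Num.max b 0)|
      <= C * `|a - b|.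
    wlog ab : a b / a <= b => [H|].
      have [|/ltW ba] := leP a b; first exact: H.
      by rewrite distrC (distrC a); exact: H.
    rewrite distrC (le_trans (source_lip _ lw i _ _ _ _))//.
    - by rewrite le_max lexx orbT.
    - by rewrite ge_max !le_max ab lexx !orbT.
    rewrite mulrA ler_wpM2l//.
    have -> : `|a - b| = b - a by rewrite distrC ger0_norm// subr_ge0.
    by case: (leP a 0) => ?; case: (leP b 0) => ?; lra.
  have e1 : 0 < e / (C + 1) by rewrite divr_gt0// ltr_wpDl.
  apply/nbhs_ballP; exists (e / (C + 1)) => // u.
  rewrite /ball /= ltr_pdivlMr ?ltr_wpDl// => h.
  rewrite (le_lt_trans (lipg _ _))//; apply: le_lt_trans h.
  by rewrite mulrC ler_wpM2l// lerDl.
have [f [f0 df]] := @linear_ode R _ (L i) (x0 i) cg.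
by exists f; split=> // t t0; have := df t t0; rewrite max_l.
Qed.

Lemma response_near w i (t : R) : is_lip_curve w -> 0 <= t ->
  `|response w i t - x0 i| <= M * t.
Proof.
move=> lw t0; have [f0 df] := responseP _ i lw.
set f := response w i in f0 df *.
have src (u : R) : 0 <= u -> `|source w i u - L i * x0 i - K i x0| <= L i * (M * u).
  move=> u0; have := source_lip _ lw i _ _ (lexx 0) u0.
  have -> : source w i 0 = L i * x0 i + K i x0.
    by rewrite /source lw.1; congr (_ + K _ _); apply/funext => j; rewrite lw.1.
  by rewrite subr0 opprD addrA.
have /ler_normlP[k1 k2] := boundK i.
rewrite ler_norml; apply/andP; split.
  suff : - f t - M * t <= - x0 i by lra.
  apply: (@barrier_closed R (fun t => - f t - M * t)
    (fun t => - (source w i t - L i * f t) - M)) t0 => /=.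
  - by rewrite f0; lra.
  - move=> u u0; have dfu := df u u0; derive_to; ring.
  - move=> u u0 h; have := src u u0 => /ler_normlP[].
    have : 0 <= L i * (- f u - M * u + x0 i) by rewrite mulr_ge0//; lra.
    lra.
suff : f t - M * t <= x0 i by lra.
apply: (@barrier_closed R (fun t => f t - M * t)
  (fun t => source w i t - L i * f t - M)) t0 => /=.
- by rewrite f0; lra.
- move=> u u0; have dfu := df u u0; derive_to; ring.
- move=> u u0 h; have := src u u0 => /ler_normlP[].
  have : 0 <= L i * (f u - M * u - x0 i) by rewrite mulr_ge0//; lra.
  lra.
Qed.

(** The difference of f and its translate by h satisfies a linear equation with
    damping L_i and a source at most L_i M h, hence never exceeds M h; the
    damping compensates exactly the Lipschitz constant of the source. *)
Lemma response_lip w : is_lip_curve w -> is_lip_curve (response w).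
Proof.
move=> lw; split=> [i|i s t s0 st]; first by have [] := responseP _ i lw.
have [f0 df] := responseP _ i lw.
set h := t - s; have h0 : 0 <= h by rewrite subr_ge0.
have -> : t = s + h by rewrite /h; lra.
have fh := response_near _ i _ lw h0.
set f := response w i in f0 df fh *.
have dfh (u : R) : 0 <= u -> is_derive u 1 (fun v => f (v + h))
    (source w i (u + h) - L i * f (u + h)).
  move=> u0; eapply der_eq.
    apply: (@der_comp _ f).
      by apply: df; rewrite addr_ge0.
  ring.
have src (u : R) : 0 <= u -> `|source w i (u + h) - source w i u| <= L i * (M * h).
  move=> u0; have := source_lip _ lw i u (u + h) u0.
  have -> : u + h - u = h by lra.
  by rewrite lerDl; exact.
rewrite ler_norml; move: fh; rewrite ler_norml -f0 => /andP[fh1 fh2].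
apply/andP; split.
  suff : f s - f (s + h) <= M * h by lra.
  apply: (@barrier_closed R (fun u => f u - f (u + h))
    (fun u => (source w i u - L i * f u) -
              (source w i (u + h) - L i * f (u + h)))) s0 => /=.
  - by rewrite add0r; lra.
  - by move=> u u0; have ? := df u u0; have ? := dfh u u0; der.
  - move=> u u0 ?; have := src u u0 => /ler_normlP[].
    have : 0 <= L i * (f u - f (u + h) - M * h) by rewrite mulr_ge0//; lra.
    lra.
apply: (@barrier_closed R (fun u => f (u + h) - f u)
  (fun u => (source w i (u + h) - L i * f (u + h)) -
            (source w i u - L i * f u))) s0 => /=.
- by rewrite add0r; lra.
- by move=> u u0; have ? := df u u0; have ? := dfh u u0; der.
- move=> u u0 ?; have := src u u0 => /ler_normlP[].
  have : 0 <= L i * (f (u + h) - f u - M * h) by rewrite mulr_ge0//; lra.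
  lra.
Qed.

Lemma response_mono w w' : is_lip_curve w -> is_lip_curve w' ->
  (forall i (t : R), 0 <= t -> w i t <= w' i t) ->
  forall i (t : R), 0 <= t -> response w i t <= response w' i t.
Proof.
move=> lw lw' ww' i t t0.
have [f0 df] := responseP _ i lw; have [f0' df'] := responseP _ i lw'.
set f := response w i in f0 df *; set f' := response w' i in f0' df' *.
rewrite -subr_le0.
apply: (@barrier_closed R (fun u => f u - f' u)
  (fun u => (source w i u - L i * f u) - (source w' i u - L i * f' u))) t0 => /=.
- by rewrite f0 f0' subrr.
- by move=> u u0; have ? := df u u0; have ? := df' u u0; der.
- move=> u u0 ?.
  have : source w i u <= source w' i u by apply: monoK => j; exact: ww'.
  have : 0 <= L i * (f u - f' u) by rewrite mulr_ge0//; lra.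
  lra.
Qed.

(** Post-fixed points of the response; their supremum is its greatest fixed
    point by the Knaster-Tarski argument. *)
Definition sub_curve w := is_lip_curve w /\
  forall i (t : R), 0 <= t -> w i t <= response w i t.

Definition max_curve i (t : R) : R := sup [set w i t | w in sub_curve].

Lemma lip_near w i (t : R) : is_lip_curve w -> 0 <= t -> `|w i t - x0 i| <= M * t.
Proof. by move=> [w0 lw] t0; rewrite -w0 -{2}[t]subr0; exact: lw. Qed.

Lemma sub_curve_bottom : sub_curve (fun i t => x0 i - M * t).
Proof.
have l : is_lip_curve (fun i t => x0 i - M * t).
  split=> [i|i s t s0 st]; first by rewrite mulr0 subr0.
  have c0 : 0 <= M * (t - s) by rewrite mulr_ge0 ?subr_ge0 ?speed_ge0.
  by rewrite ler_norml; apply/andP; split; lra.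
split=> // i t t0; have := response_near _ i _ l t0.
by rewrite ler_norml; lra.
Qed.

Lemma max_curve_ub w i (t : R) : 0 <= t -> sub_curve w -> w i t <= max_curve i t.
Proof.
move=> t0 sw; apply: ub_le_sup; last by exists w.
exists (x0 i + M * t) => _ [v [lv _] <-].
by have := lip_near _ i _ lv t0; rewrite ler_norml; lra.
Qed.

Lemma max_curve_le i (t a : R) : (forall w, sub_curve w -> w i t <= a) ->
  max_curve i t <= a.
Proof.
move=> h; apply: ge_sup; last by move=> _ [v sv <-]; exact: h.
by eexists; eexists; first exact: sub_curve_bottom.
Qed.

Lemma max_curve_lip : is_lip_curve max_curve.
Proof.
have b := sub_curve_bottom.
split=> [i|i s t s0 st].
  apply/eqP; rewrite eq_le; apply/andP; split.
    by apply: max_curve_le => w sw; rewrite sw.1.1.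
  by have := max_curve_ub _ i _ (lexx 0) b; rewrite mulr0 subr0.
have t0 := le_trans s0 st.
rewrite ler_norml; apply/andP; split.
  suff : max_curve i s <= max_curve i t + M * (t - s) by lra.
  apply: max_curve_le => w sw; have := max_curve_ub w i t t0 sw.
  by have := sw.1.2 i s t s0 st; rewrite ler_norml; lra.
suff : max_curve i t <= max_curve i s + M * (t - s) by lra.
apply: max_curve_le => w sw; have := max_curve_ub w i s s0 sw.
by have := sw.1.2 i s t s0 st; rewrite ler_norml; lra.
Qed.

Lemma max_curve_fixed i (t : R) : 0 <= t -> response max_curve i t = max_curve i t.
Proof.
have lm := max_curve_lip; have lr := response_lip _ lm.
have le1 j (u : R) : 0 <= u -> max_curve j u <= response max_curve j u.
  move=> u0; apply: max_curve_le => w sw; have [lw hw] := sw.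
  apply: le_trans (hw j u u0) _; apply: (response_mono _ _ lw lm) => // k v v0.
  exact: max_curve_ub.
move=> t0; apply/eqP; rewrite eq_le le1// andbT; apply: max_curve_ub => //.
by split=> // j u u0; apply: (response_mono _ _ lm lr) => // k v v0; exact: le1.
Qed.

(** The response itself, rather than the fixed point that it equals on the
    half-line, is returned because it is differentiable on both sides at 0. *)
Lemma quasimonotone_flow : exists x : V -> R -> R,
  (forall i, x i 0 = x0 i) /\
  forall i (t : R), 0 <= t ->
    is_derive t 1 (x i) (K i (x ^~ t)) /\ `|K i (x ^~ t)| <= M.
Proof.
have lm := max_curve_lip; have lr := response_lip _ lm.
exists (response max_curve); split; first exact: lr.1.
move=> i t t0.
have d : is_derive t 1 (response max_curve i) (K i ((response max_curve) ^~ t)).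
  have [_ /(_ t t0)] := responseP _ i lm.
  rewrite max_curve_fixed// /source addrAC subrr add0r.
  by have -> : max_curve^~ t = (response max_curve)^~ t
    by apply/funext => j; rewrite max_curve_fixed.
split=> //; apply: derive_lip d _ => h h0.
have := lr.2 i t (t + h) t0; rewrite lerDl ltW// => /(_ isT).
by have -> : t + h - t = h by lra.
Qed.

End Existence.

(** * Comparison in the sup norm *)

Section Comparison.
Context {R : realType} {V : Type}.

(** A supremum over infinitely many coordinates is neither attained nor known to
    be differentiable, so Gronwall's inequality is replaced by halving: with
    weight exp (2 C t), a bound b on all z_i improves to b / 2. *)
Lemma sup_comparison (z dz : V -> R -> R) (B C : R) : 0 <= B -> 1 <= C ->
  (forall i, z i 0 = 0) -> (forall i, z i t @[t --> 0^'+] --> 0) ->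
  (forall i (t : R), 0 < t -> is_derive t 1 (z i) (dz i t)) ->
  (forall i (t : R), 0 <= t -> z i t <= B * t) ->
  (forall i (t D : R), 0 < t -> 0 <= D -> (forall j, z j t <= D) ->
    0 < z i t -> dz i t <= C * D) ->
  forall i (t : R), 0 <= t -> z i t <= 0.
Proof.
move=> B0 C1 z0 cz hz zB dzC.
have claim n : forall i (t : R), 0 <= t ->
    z i t <= B / 2 ^+ n * expR (2 * C * t).
  elim: n => [|n IH] i t t0.
    rewrite expr0 divr1 (le_trans (zB i t t0))// ler_wpM2l//.
    (* the linear a priori bound: t <= exp (2 C t) as C >= 1 *)
    have h := expR_ge1Dx (2 * C * t).
    have : 0 <= (2 * C - 1) * t by rewrite mulr_ge0//; lra.
    lra.
  set b := B / 2 ^+ n in IH *.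
  have b0 : 0 <= b by rewrite divr_ge0// exprn_ge0.
  have -> : B / 2 ^+ n.+1 = b / 2 by rewrite exprS invfM mulrCA mulrC.
  rewrite -subr_le0.
  apply: (@barrier R (fun t => z i t - b / 2 * expR (2 * C * t))
     (fun t => dz i t - C * (b * expR (2 * C * t)))) t0 => /=.
  - by rewrite z0 mulr0 expR0; lra.
  - apply: cvgB; first by rewrite z0; exact: cz.
    apply: (@cvg_at_right_filter _ _ (fun t => b / 2 * expR (2 * C * t))).
    have d : is_derive (0 : R) 1 (fun t => b / 2 * expR (2 * C * t))
      (b / 2 * (expR (2 * C * 0) * (2 * C))) by derive_to; ring.
    exact: is_derive_continuous d.
  - by move=> u u0; have dzu := hz i u u0; derive_to; field.
  - move=> u u0 h; rewrite subr_le0; apply: dzC => //.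
    + by rewrite mulr_ge0 ?expR_ge0.
    + by move=> j; apply: IH; exact: ltW.
    + have : 0 <= b / 2 * expR (2 * C * u) by rewrite mulr_ge0 ?expR_ge0//; lra.
      lra.
move=> i t t0; rewrite leNgt; apply/negP => zt.
(* let n go to infinity in the claim *)
set A := B * expR (2 * C * t).
have A0 : 0 <= A / z i t by rewrite divr_ge0 ?mulr_ge0 ?expR_ge0// ltW.
have := archi_boundP A0; set n := Num.bound _.
rewrite ltr_pdivrMr// => h1.
have := claim n i t t0; rewrite mulrAC ler_pdivlMr ?exprn_gt0// -/A => h2.
have : n%:R * z i t <= z i t * 2 ^+ n.
  rewrite mulrC ler_wpM2l//; first exact: ltW.
  by rewrite -natrX ler_nat ltnW// ltn_expl.
by lra.
Qed.

End Comparison.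

(** * The two geometries in common notation *)

Section UnifiedFunctions.
Context {R : realType}.
Implicit Types (g : geometry) (x y h T : R).

Definition gcosh g x := match g with Euclidean => expR x | Hyperbolic => cosh x end.
Definition gsinh g x := match g with Euclidean => expR x | Hyperbolic => sinh x end.
Definition gconst g : R := match g with Euclidean => 0 | Hyperbolic => 1 end.

Lemma der_gcosh g f x a : is_derive x 1 f a ->
  is_derive x 1 (fun t : R => gcosh g (f t)) (gsinh g (f x) * a).
Proof.
by move=> df; case: g; rewrite /gcosh /gsinh /cosh /sinh; derive_to => //; field.
Qed.

Lemma der_gsinh g f x a : is_derive x 1 f a ->
  is_derive x 1 (fun t : R => gsinh g (f t)) (gcosh g (f x) * a).
Proof.
by move=> df; case: g; rewrite /gcosh /gsinh /cosh /sinh; derive_to => //; field.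
Qed.

Lemma expRVN x : expR x * expR (- x) = 1.
Proof. by rewrite -expRD subrr expR0. Qed.

Lemma gcosh2Bgsinh2 g x : gcosh g x ^+ 2 - gsinh g x ^+ 2 = gconst g.
Proof.
case: g; rewrite /gcosh /gsinh /cosh /sinh /gconst; first by rewrite subrr.
by rewrite -[RHS](expRVN x); field.
Qed.

Lemma cosh_ge1 x : 1 <= cosh x.
Proof.
have := expRVN x; rewrite /cosh; move: (expR_gt0 x) (expR_gt0 (- x)).
set a := expR x; set b := expR (- x) => a0 b0 ab.
have : 0 <= (a - b) ^+ 2 by exact: sqr_ge0.
by rewrite ler_pdivlMr// mul1r; nra.
Qed.

Lemma gconst_le g x y : gconst g <= gcosh g x * gcosh g y.
Proof.
case: g; rewrite /gconst /gcosh; first by rewrite mulr_ge0 ?expR_ge0.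
by rewrite mulr_ege1 ?cosh_ge1.
Qed.

Lemma gsinh_le g x y : x <= y -> gsinh g x <= gsinh g y.
Proof.
move=> xy; have : expR x <= expR y by rewrite ler_expR.
have : expR (- y) <= expR (- x) by rewrite ler_expR lerN2.
by case: g; rewrite /gsinh /sinh//; lra.
Qed.

Lemma gcosh_le g x y : 0 <= gsinh g x -> x <= y -> gcosh g x <= gcosh g y.
Proof.
move=> sx xy; have h0 : 0 <= y - x by rewrite subr_ge0.
have -> : y = x + (y - x) by lra.
rewrite -subr_le0.
apply: (@barrier_closed R (fun h => gcosh g x - gcosh g (x + h))
  (fun h => - gsinh g (x + h))) h0 => [|u u0|u u0 _].
- by rewrite addr0 subrr.
- have d : is_derive u 1 (fun h => gcosh g (x + h)) (gsinh g (x + u) * (0 + 1)).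
    by apply: der_gcosh; der.
  by derive_to; ring.
- by rewrite oppr_le0 (le_trans sx)// gsinh_le// lerDl.
Qed.

(** The difference of the two sides is - sinh h (cosh (x - y) + cos T) in the
    hyperbolic case and 0 in the Euclidean one.  It says that the cotangent of
    the angle does not increase along the diagonal. *)
Lemma cotangle_diagonal g T x y h : -1 < cos T -> 0 <= h ->
  (gcosh g (y + h) + gcosh g (x + h) * cos T) * gsinh g x <=
  (gcosh g y + gcosh g x * cos T) * gsinh g (x + h).
Proof.
move=> C h0; rewrite -subr_le0; case: g; rewrite /gcosh /gsinh.
  by rewrite !expRD le_eqVlt; apply/orP; left; apply/eqP; ring.
have -> : (cosh (y + h) + cosh (x + h) * cos T) * sinh x -
    (cosh y + cosh x * cos T) * sinh (x + h) =
    - (sinh h * (cosh (x - y) + cos T)).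
  transitivity (- sinh h * cosh (x - y) -
     sinh h * (expR x * expR (- x)) * cos T); last by rewrite expRVN; ring.
  by rewrite /cosh /sinh !opprD !opprK !expRD; field.
have := cosh_ge1 (x - y); have : 0 <= sinh h.
  by have := gsinh_le Hyperbolic _ _ h0; rewrite /gsinh {1}/sinh oppr0 expR0 subrr mul0r.
by move=> ? ?; rewrite oppr_le0 mulr_ge0//; lra.
Qed.

End UnifiedFunctions.

(** * The arc cotangent *)

Section Cotangent.
Context {R : realType}.
Implicit Types (x y z h : R).

Lemma cos_itv x : 0 < sin x -> -1 < cos x < 1.
Proof.
move=> S0; have := cos2Dsin2 x; have : 0 < sin x ^+ 2 by rewrite exprn_gt0.
by nra.
Qed.

Lemma sin_le_id x : 0 <= x -> sin x <= x.
Proof.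
move=> x0; rewrite -subr_le0.
apply: (@barrier_closed R (fun t => sin t - t) (fun t => cos t - 1)) x0.
- by rewrite sin0 subrr.
- by move=> t _ _; rewrite subr_le0 cos_le1.
Qed.

(** An angle in the upper half-plane exceeds its sine. *)
Lemma acot_ge z : (Num.sqrt (1 + z ^+ 2))^-1 <= pi / 2 - atan z.
Proof.
rewrite -cos_atan -[leLHS](_ : sin (pi / 2 - atan z) = _); last first.
  by rewrite sinB sin_pihalf cos_pihalf mul1r mul0r subr0.
by rewrite sin_le_id// subr_ge0 ltW// atan_ltpi2.
Qed.

Lemma sin_atan z : sin (atan z) = z / Num.sqrt (1 + z ^+ 2).
Proof.
rewrite -cos_atan -{2}[z]atanK /tan divfK//.
by apply/lt0r_neq0/cos_gt0_pihalf; rewrite atan_gtNpi2 atan_ltpi2.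
Qed.

Lemma acos_acot (p q : R) : 0 < q ->
  acos (p / Num.sqrt (p ^+ 2 + q ^+ 2)) = pi / 2 - atan (p / q).
Proof.
move=> q0; have h1 := @atan_ltpi2 R (p / q); have h2 := @atan_gtNpi2 R (p / q).
rewrite -[RHS]cosK; last by rewrite in_itv /=; apply/andP; split; lra.
congr acos; rewrite cosB cos_pihalf sin_pihalf mul0r mul1r add0r sin_atan.
have -> : 1 + (p / q) ^+ 2 = (p ^+ 2 + q ^+ 2) / q ^+ 2.
  by field; rewrite lt0r_neq0.
rewrite sqrtrM ?addr_ge0 ?sqr_ge0// sqrtrV ?sqr_ge0// sqrtr_sqr gtr0_norm//.
have s0 : 0 < Num.sqrt (p ^+ 2 + q ^+ 2).
  by rewrite sqrtr_gt0 ltr_wpDl ?sqr_ge0// exprn_gt0.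
by field; rewrite !lt0r_neq0.
Qed.

End Cotangent.

(** * The angle of an edge as a function of the coordinates *)

Section Angle.
Context {R : realType} (g : geometry) (T : R).
Hypothesis S0 : 0 < sin T.
Implicit Types (x y h : R).

Let sinT2 : sin T ^+ 2 = 1 - cos T ^+ 2.
Proof. by rewrite -(cos2Dsin2 T); ring. Qed.

(** The cotangent (four-part) formula for a triangle with two sides enclosing the
    angle pi - T, written in the coordinates. *)
Definition cotangle x y : R :=
  (gcosh g y + gcosh g x * cos T) / (gsinh g x * sin T).

Definition angle x y : R := pi / 2 - atan (cotangle x y).

Lemma cotangle_norm x y : 0 < gsinh g x ->
  1 + cotangle x y ^+ 2 =
  ((gsinh g x * sin T) ^+ 2 + (gcosh g y + gcosh g x * cos T) ^+ 2) /
  (gsinh g x * sin T) ^+ 2.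
Proof. by move=> s0; rewrite /cotangle; field; rewrite !lt0r_neq0. Qed.

Lemma addr1_sqr_gt0 z : 0 < 1 + z ^+ 2 :> R.
Proof. by rewrite ltr_pwDl ?sqr_ge0. Qed.

Lemma angle_ge0 x y : 0 <= angle x y.
Proof. by rewrite subr_ge0 ltW// atan_ltpi2. Qed.

Lemma angle_le x y x' y' : cotangle x' y' <= cotangle x y ->
  angle x y <= angle x' y'.
Proof. by move=> h; rewrite lerB// le_atan. Qed.

Lemma angle_decr x y y' : 0 < gsinh g x -> 0 <= gsinh g y -> y <= y' ->
  angle x y' <= angle x y.
Proof.
move=> sx sy yy; apply: angle_le; rewrite ler_wpM2r//.
  by rewrite invr_ge0 ltW// mulr_gt0.
by rewrite lerD2r gcosh_le.
Qed.

Lemma angle_diagonal x y h : 0 < gsinh g x -> 0 <= h ->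
  angle x y <= angle (x + h) (y + h).
Proof.
move=> sx h0; apply: angle_le.
have sxh : 0 < gsinh g (x + h) by rewrite (lt_le_trans sx)// gsinh_le// lerDl.
rewrite ler_pdivrMr ?mulr_gt0// mulrAC ler_pdivlMr ?mulr_gt0//.
have := cotangle_diagonal g T x y h.
have /andP[h1 _] := cos_itv T S0; move=> /(_ h1 h0); rewrite !mulrA => H.
by rewrite ler_wpM2r// ltW.
Qed.

(** With c, s, k for the values of [gcosh], [gsinh] and [gconst], the x-derivative is
      sin T (k cos T + c(x) c(y)) / (s(x)^2 sin^2 T + (c(y) + c(x) cos T)^2),
    and the denominator exceeds (1 + cos T) (k cos T + c(x) c(y)) by
      (c(x) - c(y))^2 + (1 + cos T) (c(x) c(y) - k) >= 0. *)
Lemma angle_lip x y h : 0 < gsinh g x -> 0 <= h ->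
  angle (x + h) y - angle x y <= sin T / (1 + cos T) * h.
Proof.
move=> sx h0; have /andP[c1 c2] := cos_itv T S0.
set L := sin T / (1 + cos T).
suff : angle (x + h) y - L * h <= angle x y by lra.
pose D u := (gconst g * cos T + gcosh g (x + u) * gcosh g y) /
   (gsinh g (x + u) ^+ 2 * sin T).
have sxh (u : R) : 0 <= u -> 0 < gsinh g (x + u).
  by move=> u0; rewrite (lt_le_trans sx)// gsinh_le// lerDl.
apply: (@barrier_closed R (fun u => angle (x + u) y - L * u)
  (fun u => D u / (1 + cotangle (x + u) y ^+ 2) - L)) h0 => [|u u0|u u0 _].
- by rewrite addr0; lra.
- have dx : is_derive u 1 (fun u : R => x + u) 1 by derive_to; ring.
  have dc := der_gcosh g _ _ _ dx; have ds := der_gsinh g _ _ _ dx.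
  have su := sxh u u0.
  have dz : is_derive u 1 (fun u => cotangle (x + u) y) (- D u).
    have n0 : gsinh g (x + u) * sin T != 0 by rewrite lt0r_neq0// mulr_gt0.
    have dn : is_derive u 1 (fun u => (gsinh g (x + u) * sin T)^-1)
       (- (gcosh g (x + u) * sin T) / (gsinh g (x + u) * sin T) ^+ 2).
      have dm : is_derive u 1 (fun u => gsinh g (x + u) * sin T)
        (gcosh g (x + u) * sin T) by derive_to; ring.
      exact: (der_inv (fun u => gsinh g (x + u) * sin T) u _ n0 dm).
    derive_to; rewrite /D -(gcosh2Bgsinh2 g (x + u)); field.
    by rewrite !lt0r_neq0.
  by derive_to; rewrite mulNr; ring.
- have su := sxh u u0; rewrite subr_le0 ler_pdivrMr ?addr1_sqr_gt0// cotangle_norm//.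
  rewrite /D /L.
  have -> : sin T / (1 + cos T) * (((gsinh g (x + u) * sin T) ^+ 2 +
      (gcosh g y + gcosh g (x + u) * cos T) ^+ 2) / (gsinh g (x + u) * sin T) ^+ 2)
    = (((gsinh g (x + u) * sin T) ^+ 2 +
      (gcosh g y + gcosh g (x + u) * cos T) ^+ 2) / (1 + cos T)) /
      (gsinh g (x + u) ^+ 2 * sin T).
    by field; rewrite !lt0r_neq0//; lra.
  apply: ler_wpM2r; first by rewrite invr_ge0 ltW// mulr_gt0// exprn_gt0.
  rewrite ler_pdivlMr; last by lra.
  have := gconst_le g (x + u) y; have := gcosh2Bgsinh2 g (x + u).
  have := sinT2.
  set a := gcosh g (x + u); set b := gcosh g y; set s := gsinh g _.
  set k := gconst g; set C := cos T in c1 c2 *; move=> E1 E2 E3.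
  rewrite exprMn E1 -subr_ge0.
  have -> : s ^+ 2 = a ^+ 2 - k by rewrite -E2; ring.
  have -> : (a ^+ 2 - k) * (1 - C ^+ 2) + (b + a * C) ^+ 2 -
     (k * C + a * b) * (1 + C) = (a - b) ^+ 2 + (1 + C) * (a * b - k) by ring.
  by rewrite addr_ge0 ?sqr_ge0// mulr_ge0//; lra.
Qed.

(** The y-derivative is controlled by the angle itself, not merely bounded: this
    makes the sum over the edges at a vertex depend on the curvature and not
    on the degree.  The law of sines is hidden in
      s(x)^2 sin^2 T + (c(y) + c(x) cos T)^2
        = s(y)^2 sin^2 T + (c(x) + c(y) cos T)^2. *)
Lemma angle_log_lip x y h : 0 < gsinh g x -> 0 <= gsinh g y -> 0 <= h ->
  angle x y - angle x (y + h) <= angle x y / sin T * h.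
Proof.
move=> sx sy h0.
suff : angle x y * (1 - h / sin T) - angle x (y + h) <= 0 by lra.
pose D u := gsinh g (y + u) / (gsinh g x * sin T).
have syh (u : R) : 0 <= u -> 0 <= gsinh g (y + u).
  by move=> u0; rewrite (le_trans sy)// gsinh_le// lerDl.
have n0 : gsinh g x * sin T != 0 by rewrite lt0r_neq0// mulr_gt0.
apply: (@barrier_closed R (fun u => angle x y * (1 - u / sin T) - angle x (y + u))
  (fun u => D u / (1 + cotangle x (y + u) ^+ 2) - angle x y / sin T)) h0
    => [|u u0|u u0 _].
- by rewrite addr0 mul0r subr0 mulr1 subrr.
- have dy : is_derive u 1 (fun u : R => y + u) 1 by derive_to; ring.
  have dc := der_gcosh g _ _ _ dy.
  have dz : is_derive u 1 (fun u => cotangle x (y + u)) (D u).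
    by derive_to; rewrite /D; field; rewrite !lt0r_neq0.
  by derive_to; field; rewrite !lt0r_neq0// ?addr1_sqr_gt0.
- have su := syh u u0; rewrite subr_le0.
  have le2 : angle x (y + u) / sin T <= angle x y / sin T.
    by rewrite ler_wpM2r ?invr_ge0 ?(ltW S0)// angle_decr// lerDl.
  apply: le_trans le2.
  rewrite /D invfM mulrA mulrAC ler_wpM2r ?invr_ge0 ?(ltW S0)//.
  apply: le_trans (acot_ge _).
  set N := 1 + cotangle x (y + u) ^+ 2.
  have N0 : 0 < N by exact: addr1_sqr_gt0.
  have sN0 : 0 < Num.sqrt N by rewrite sqrtr_gt0.
  have sNK : (Num.sqrt N)^-1 * N = Num.sqrt N.
    by rewrite -{2}(sqr_sqrtr (ltW N0)) expr2 mulrA mulVf ?lt0r_neq0// mul1r.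
  rewrite ler_pdivrMr// sNK.
  rewrite -[leLHS]ger0_norm ?divr_ge0 ?(ltW sx)// -sqrtr_sqr ler_wsqrtr//.
  rewrite /N cotangle_norm// ler_pdivlMr ?exprn_gt0 ?mulr_gt0//.
  rewrite -exprMn mulrA divfK ?lt0r_neq0// -subr_ge0.
  have := sinT2; have := gcosh2Bgsinh2 g x; have := gcosh2Bgsinh2 g (y + u).
  set a := gcosh g x; set b := gcosh g _; set s := gsinh g x.
  set s' := gsinh g _; set k := gconst g; set C := cos T => E1 E2 E3.
  rewrite !exprMn E3.
  have -> : s ^+ 2 = a ^+ 2 - k by rewrite -E2; ring.
  have -> : s' ^+ 2 = b ^+ 2 - k by rewrite -E1; ring.
  have -> : (a ^+ 2 - k) * (1 - C ^+ 2) + (b + a * C) ^+ 2 -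
     (b ^+ 2 - k) * (1 - C ^+ 2) = (a + b * C) ^+ 2 by ring.
  exact: sqr_ge0.
Qed.

End Angle.

(** * Extension of the angle to all real coordinates *)

Section TotalAngle.
Context {R : realType}.
Implicit Types (g : geometry) (T x y h : R).

Definition angle_lip_const T : R := sin T / (1 + cos T).

Lemma angle_lip_const_ge0 T : 0 < sin T -> 0 <= angle_lip_const T.
Proof.
move=> S0; have /andP[c1 c2] := cos_itv T S0.
by apply: divr_ge0; [exact: ltW|lra].
Qed.

Lemma sinh_gt0 x : (0 < sinh x) = (0 < x).
Proof.
rewrite /sinh pmulr_lgt0 ?invr_gt0// subr_gt0 ltr_expR.
by apply/idP/idP => ?; lra.
Qed.

Lemma sinh0 : sinh 0 = 0 :> R.
Proof. by rewrite /sinh oppr0 subrr mul0r. Qed.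

Lemma cosh0 : cosh 0 = 1 :> R.
Proof. by rewrite /cosh oppr0 expR0; field. Qed.

(** The angle tends to 0 when the radius at its vertex goes to infinity,
    uniformly in the other radius; the Lipschitz bound up to that limit turns
    this into a linear rate. *)
Lemma angle_ideal T x y : 0 < sin T -> 0 < x -> 0 <= y ->
  angle Hyperbolic T x y <= angle_lip_const T * x.
Proof.
move=> S0 x0 y0; apply/ler_addgt0Pr => e e0.
have /andP[c1 c2] := cos_itv T S0.
have [A eA] : exists A, pi / 2 - e < atan A.
  have : \forall A \near +oo, pi / 2 - e < @atan R A.
    by apply: (cvgr_gt (pi / 2)); [exact: cvgy_atan|rewrite ltrBlDr ltrDl].
  (* the filter at infinity only gives the bound strictly beyond A *)
  move=> [A [_ hA]]; exists (A + 1); apply: hA; by rewrite ltrDl.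
pose f u : R := cosh y + cosh u * cos T - A * (sinh u * sin T).
have f0 : 0 < f 0.
  by have := cosh_ge1 y; rewrite /f sinh0 cosh0; lra.
have cf : f u @[u --> 0^'+] --> f 0.
  apply: cvg_at_right_filter.
  have dc := der_gcosh Hyperbolic _ _ _ (der_id (0 : R)).
  have ds := der_gsinh Hyperbolic _ _ _ (der_id (0 : R)).
  have : is_derive (0 : R) 1 f (sinh 0 * cos T - A * (cosh 0 * sin T)).
    by rewrite /f; derive_to; rewrite /=; ring.
  exact: is_derive_continuous.
near (0 : R)^'+ => u.
have fu : 0 < f u by near: u; exact: (cvgr_gt (f 0)).
have u0 : 0 < u by near: u; exact: nbhs_right_gt.
have ux : u < x by near: u; exact: nbhs_right_lt.
have su : 0 < gsinh Hyperbolic u by rewrite /= sinh_gt0.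
have := angle_lip Hyperbolic T S0 u y (x - u) su.
rewrite subr_ge0 (addrC u) subrK => /(_ (ltW ux)).
have : angle Hyperbolic T u y <= e.
  suff : atan A <= atan (cotangle Hyperbolic T u y) by rewrite /angle; lra.
  rewrite le_atan// ler_pdivlMr; last exact: mulr_gt0.
  by move: fu; rewrite /f /=; lra.
have : 0 <= angle_lip_const T * u by rewrite mulr_ge0 ?(ltW u0)// angle_lip_const_ge0.
rewrite /angle_lip_const; lra.
Unshelve. all: by end_near. Qed.

(** Hyperbolic coordinates are positive, but curves in the fixed-point argument
    may leave the half-line.  A nonpositive coordinate stands for a circle of
    infinite radius: angles at it vanish, and other angles see it as 0. *)
Definition clip g y : R :=
  match g with Euclidean => y | Hyperbolic => Num.max y 0 end.

Definition ext_angle g T x y : R :=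
  if 0 < gsinh g x then angle g T x (clip g y) else 0.

Lemma gsinh_clip g y : 0 <= gsinh g (clip g y).
Proof.
case: g => /=; first exact: expR_ge0.
have : 0 <= Num.max y 0 by rewrite le_max lexx orbT.
by rewrite le_eqVlt => /predU1P[<-|]; rewrite ?/sinh ?oppr0 ?subrr ?mul0r// -sinh_gt0 => /ltW.
Qed.

Lemma clip_le g y y' : y <= y' -> clip g y <= clip g y'.
Proof. by case: g => //= yy; case: (leP y 0) => ?; case: (leP y' 0) => ?; lra. Qed.

Lemma clip_add g y h : 0 <= h -> clip g (y + h) <= clip g y + h.
Proof. by case: g => //= h0; case: (leP y 0) => ?; case: (leP (y + h) 0) => ?; lra. Qed.

Lemma ext_angle_ge0 g T x y : 0 <= ext_angle g T x y.
Proof. by rewrite /ext_angle; case: ifP => // _; exact: angle_ge0. Qed.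

Lemma ext_angle_decr g T x y y' : 0 < sin T -> y <= y' ->
  ext_angle g T x y' <= ext_angle g T x y.
Proof.
move=> S0 yy; rewrite /ext_angle; case: ifP => // sx.
by apply: angle_decr => //; [exact: gsinh_clip|exact: clip_le].
Qed.

Lemma ext_angle_diagonal g T x y h : 0 < sin T -> 0 <= h ->
  ext_angle g T x y <= ext_angle g T (x + h) (y + h).
Proof.
move=> S0 h0; rewrite {1}/ext_angle; case: ifPn => [sx|_]; last exact: ext_angle_ge0.
have sxh : 0 < gsinh g (x + h) by rewrite (lt_le_trans sx)// gsinh_le// lerDl.
rewrite /ext_angle sxh; apply: le_trans (angle_diagonal _ _ S0 _ (clip g y) _ sx h0) _.
by apply: angle_decr => //; [exact: gsinh_clip|exact: clip_add].
Qed.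

Lemma ext_angle_incr g T x x' y : 0 < sin T -> x <= x' ->
  ext_angle g T x y <= ext_angle g T x' y.
Proof.
move=> S0 xx; have h0 : 0 <= x' - x by rewrite subr_ge0.
have := ext_angle_diagonal g T x y _ S0 h0; have -> : x + (x' - x) = x' by lra.
by move/le_trans; apply; apply: ext_angle_decr => //; rewrite lerDl.
Qed.

Lemma ext_angle_ideal T x y : 0 < sin T -> 0 <= x ->
  ext_angle Hyperbolic T x y <= angle_lip_const T * x.
Proof.
move=> S0 x0; have L0 := angle_lip_const_ge0 T S0.
rewrite /ext_angle; case: ifP => [|_]; last by rewrite mulr_ge0.
rewrite /= sinh_gt0 => {}x0; apply: angle_ideal => //.
by rewrite le_max lexx orbT.
Qed.

Lemma ext_angle_lip g T x x' y : 0 < sin T -> x <= x' ->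
  ext_angle g T x' y - ext_angle g T x y <= angle_lip_const T * (x' - x).
Proof.
move=> S0 xx; have L0 := angle_lip_const_ge0 T S0.
have h0 : 0 <= x' - x by rewrite subr_ge0.
have [sx|sx] := boolP (0 < gsinh g x).
  have sx' : 0 < gsinh g x' by rewrite (lt_le_trans sx)// gsinh_le.
  rewrite /ext_angle sx sx'.
  have := angle_lip g T S0 x (clip g y) _ sx h0.
  by have -> : x + (x' - x) = x' by lra.
rewrite {2}/ext_angle (negbTE sx) subr0.
case: g sx => /=; first by rewrite expR_gt0.
rewrite sinh_gt0 -leNgt => x0.
have [x'0|x'0] := leP x' 0.
  by rewrite /ext_angle /= sinh_gt0 ltNge x'0 /= mulr_ge0.
apply: le_trans (ext_angle_ideal _ _ _ S0 (ltW x'0)) _.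
by rewrite ler_wpM2l//; lra.
Qed.

Lemma ext_angle_log_lip g T x y h : 0 < sin T -> 0 <= h ->
  ext_angle g T x y - ext_angle g T x (y + h) <= ext_angle g T x y / sin T * h.
Proof.
move=> S0 h0; rewrite /ext_angle; case: ifP => sx; last by rewrite subr0 !mul0r.
apply: le_trans (angle_log_lip _ _ S0 _ _ _ sx (gsinh_clip g y) h0).
by rewrite lerB// angle_decr// ?gsinh_clip// clip_add.
Qed.

End TotalAngle.

(** * Coordinates and radii *)

Section Coordinates.
Context {R : realType}.
Implicit Types (g : geometry) (T r x a b : R) (f : R -> R).

(** This is - ln tanh (r / 2), an involution of the half-line characterized by
    sinh r * sinh (dual r) = 1. *)
Definition dual r : R := ln ((1 + expR (- r)) / (1 - expR (- r))).

Lemma expRN_itv r : 0 < r -> 0 < expR (- r) < 1.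
Proof. by move=> r0; rewrite expR_gt0 expR_lt1 oppr_lt0. Qed.

Lemma expR_dual r : 0 < r ->
  expR (dual r) = (1 + expR (- r)) / (1 - expR (- r)).
Proof.
move=> /expRN_itv/andP[e0 e1]; rewrite lnK// posrE divr_gt0//; lra.
Qed.

Lemma sinh_gt0P r : 0 < r -> 0 < sinh r.
Proof. by rewrite sinh_gt0. Qed.

Lemma sinhE r : sinh r = (1 - expR (- r) ^+ 2) / (2 * expR (- r)).
Proof.
have e0 := lt0r_neq0 (expR_gt0 (- r)).
have -> : sinh r = ((expR (- r))^-1 - expR (- r)) / 2.
  by rewrite -expRN opprK.
by field.
Qed.

Lemma coshE r : cosh r = (1 + expR (- r) ^+ 2) / (2 * expR (- r)).
Proof.
have e0 := lt0r_neq0 (expR_gt0 (- r)).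
have -> : cosh r = ((expR (- r))^-1 + expR (- r)) / 2.
  by rewrite -expRN opprK.
by field.
Qed.

Lemma sinh_dual r : 0 < r -> sinh (dual r) = (sinh r)^-1.
Proof.
move=> r0; have /andP[e0 e1] := expRN_itv r r0.
rewrite sinhE [in RHS]sinhE (expRN (dual r)) (expR_dual r r0).
set E := expR (- r) in e0 e1 *.
by field; rewrite !lt0r_neq0//; nra.
Qed.

Lemma cosh_dual r : 0 < r -> cosh (dual r) = cosh r / sinh r.
Proof.
move=> r0; have /andP[e0 e1] := expRN_itv r r0.
rewrite coshE [in RHS]sinhE [in RHS]coshE (expRN (dual r)) (expR_dual r r0).
set E := expR (- r) in e0 e1 *.
by field; rewrite !lt0r_neq0//; nra.
Qed.

Lemma dual_gt0 r : 0 < r -> 0 < dual r.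
Proof. by move=> r0; rewrite -sinh_gt0 sinh_dual// invr_gt0 sinh_gt0. Qed.

Lemma dualK r : 0 < r -> dual (dual r) = r.
Proof.
move=> r0; have /andP[e0 e1] := expRN_itv r r0.
rewrite {1}/dual (expRN (dual r)) (expR_dual r r0) -[RHS]expRK.
congr ln; have -> : expR r = (expR (- r))^-1 by rewrite -expRN opprK.
set E := expR (- r) in e0 e1 *.
by field; rewrite !lt0r_neq0//; lra.
Qed.

Lemma der_dual f x a : 0 < f x -> is_derive x 1 f a ->
  is_derive x 1 (fun t : R => dual (f t)) (- a / sinh (f x)).
Proof.
move=> f0 df; have /andP[e0 e1] := expRN_itv _ f0.
have n1 : 1 - expR (- f x) != 0 by rewrite lt0r_neq0//; lra.
have d1 : is_derive x 1 (fun t => 1 - expR (- f t)) (expR (- f x) * a).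
  by derive_to; ring.
have d2 := der_inv (fun t => 1 - expR (- f t)) x _ n1 d1.
have d3 : is_derive x 1 (fun t => (1 + expR (- f t)) / (1 - expR (- f t)))
  (- 2 * expR (- f x) * a / (1 - expR (- f x)) ^+ 2).
  by derive_to; field.
have q0 : 0 < (1 + expR (- f x)) / (1 - expR (- f x)).
  by rewrite divr_gt0//; lra.
have d4 := der_ln (fun t => (1 + expR (- f t)) / (1 - expR (- f t))) x _ q0 d3.
apply: (der_eq _ _ _ _ d4); rewrite sinhE.
by field; rewrite !lt0r_neq0//; nra.
Qed.

Definition coord g r : R := match g with Euclidean => - ln r | Hyperbolic => dual r end.

Definition radius g x : R :=
  match g with Euclidean => expR (- x) | Hyperbolic => dual x end.

Lemma coord_dom g r : 0 < r -> 0 < gsinh g (coord g r).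
Proof. by case: g => /= r0; [exact: expR_gt0|rewrite sinh_gt0 dual_gt0]. Qed.

Lemma radius_gt0 g x : 0 < gsinh g x -> 0 < radius g x.
Proof. by case: g => /=; [rewrite !expR_gt0|rewrite sinh_gt0; exact: dual_gt0]. Qed.

Lemma coordK g r : 0 < r -> radius g (coord g r) = r.
Proof. by case: g => /= r0; [rewrite opprK lnK|rewrite dualK]. Qed.

Lemma radiusK g x : 0 < gsinh g x -> coord g (radius g x) = x.
Proof. by case: g => /=; [rewrite expRK opprK|rewrite sinh_gt0; exact: dualK]. Qed.

Lemma der_coord g f x a : 0 < f x -> is_derive x 1 f a ->
  is_derive x 1 (fun t : R => coord g (f t)) (- a / flow_scale g (f x)).
Proof.
move=> f0 df; case: g => /=; last exact: der_dual.
have d := der_ln f x a f0 df.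
by derive_to; rewrite mulNr.
Qed.

Lemma der_radius g f x a : 0 < gsinh g (f x) -> is_derive x 1 f a ->
  is_derive x 1 (fun t : R => radius g (f t)) (- a * flow_scale g (radius g (f x))).
Proof.
case: g => /= f0 df; first by derive_to; ring.
move: f0; rewrite sinh_gt0 => f0; rewrite sinh_dual//; exact: der_dual.
Qed.

Lemma clip_coord g r : 0 < r -> clip g (coord g r) = coord g r.
Proof. by case: g => //= r0; rewrite max_l// ltW// dual_gt0. Qed.

Lemma ext_angle_coord g T a b : 0 < a -> 0 < b ->
  ext_angle g T (coord g a) (coord g b) = angle g T (coord g a) (coord g b).
Proof. by move=> a0 b0; rewrite /ext_angle coord_dom// clip_coord. Qed.

Lemma expR_acosh x : 1 <= x ->
  expR (acosh x) = x + Num.sqrt (x ^+ 2 - 1) /\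
  expR (- acosh x) = x - Num.sqrt (x ^+ 2 - 1).
Proof.
move=> x1; have h : 0 <= x ^+ 2 - 1 by nra.
have s0 := sqrtr_ge0 (x ^+ 2 - 1); have s2 := sqr_sqrtr h.
set s := Num.sqrt _ in s0 s2 *.
have p : 0 < x + s by lra.
rewrite /acosh -/s expRN lnK ?posrE//; split=> //.
apply: (mulfI (lt0r_neq0 p)); rewrite divff ?lt0r_neq0//.
have -> : (x + s) * (x - s) = x ^+ 2 - s ^+ 2 by ring.
by rewrite s2; ring.
Qed.

Lemma cosh_acosh x : 1 <= x -> cosh (acosh x) = x.
Proof. by move=> x1; rewrite /cosh; have [-> ->] := expR_acosh x x1; field. Qed.

Lemma sinh_acosh x : 1 <= x -> sinh (acosh x) = Num.sqrt (x ^+ 2 - 1).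
Proof. by move=> x1; rewrite /sinh; have [-> ->] := expR_acosh x x1; field. Qed.

(** The cosine given by the law of cosines is P / sqrt (P^2 + Q^2) for the
    numerator P and denominator Q of the cotangent formula. *)
Lemma inner_angleE g T a b : 0 < sin T -> 0 < a -> 0 < b ->
  inner_angle g T a b = ext_angle g T (coord g a) (coord g b).
Proof.
move=> S0 a0 b0; rewrite ext_angle_coord// /angle /cotangle.
have /andP[c1 c2] := cos_itv T S0.
have E : sin T ^+ 2 = 1 - cos T ^+ 2 by rewrite -(cos2Dsin2 T); ring.
case: g; rewrite /inner_angle /triangle_angle /edge_length /=.
  rewrite !expRN !lnK ?posrE//.
  have -> : (b^-1 + a^-1 * cos T) / (a^-1 * sin T) =
            (a + b * cos T) / (b * sin T).
    by field; rewrite !lt0r_neq0.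
  rewrite -acos_acot ?mulr_gt0//; congr acos.
  have -> : (a + b * cos T) ^+ 2 + (b * sin T) ^+ 2 =
            a ^+ 2 + b ^+ 2 + 2 * a * b * cos T.
    by rewrite exprMn E; ring.
  have h : 0 < a ^+ 2 + b ^+ 2 + 2 * a * b * cos T.
    have : 0 <= (a - b) ^+ 2 by exact: sqr_ge0.
    have : 0 < a * b * (1 + cos T) by rewrite !mulr_gt0//; lra.
    nra.
  have s0 : 0 < Num.sqrt (a ^+ 2 + b ^+ 2 + 2 * a * b * cos T) by rewrite sqrtr_gt0.
  rewrite sqr_sqrtr ?(ltW h)//; field.
  by rewrite !lt0r_neq0.
rewrite !cosh_dual// sinh_dual//.
have sa := sinh_gt0P a a0; have sb := sinh_gt0P b b0.
set A := cosh a * cosh b + sinh a * sinh b * cos T.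
have Ea := gcosh2Bgsinh2 Hyperbolic a; have Eb := gcosh2Bgsinh2 Hyperbolic b; rewrite /= in Ea Eb.
have ca := cosh_ge1 a; have cb := cosh_ge1 b.
pose P := sinh a * cosh b + cosh a * sinh b * cos T.
pose Q := sinh b * sin T.
have Q0 : 0 < Q by rewrite mulr_gt0.
have EA : A ^+ 2 - 1 = P ^+ 2 + Q ^+ 2.
  apply/eqP; rewrite -subr_eq0; apply/eqP.
  transitivity ((cosh b ^+ 2 - sinh b ^+ 2 * cos T ^+ 2) *
      (cosh a ^+ 2 - sinh a ^+ 2) - 1 - sinh b ^+ 2 * sin T ^+ 2).
    by rewrite /Q /A /P; ring.
  have cb2 : cosh b ^+ 2 = sinh b ^+ 2 + 1 by rewrite -Eb; ring.
  by rewrite Ea E cb2; ring.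
have A0 : 0 < A.
  have h1 : sinh a < cosh a by nra.
  have h2 : sinh b < cosh b by nra.
  have h3 : sinh a * sinh b < cosh a * cosh b by apply: ltr_pM => //; exact: ltW.
  have : 0 < sinh a * sinh b * (1 + cos T).
    by apply: mulr_gt0; [exact: mulr_gt0|lra].
  by rewrite /A; lra.
have A1 : 1 <= A.
  have : 0 <= A ^+ 2 - 1 by rewrite EA addr_ge0 ?sqr_ge0.
  by nra.
rewrite cosh_acosh// sinh_acosh// EA.
have -> : (cosh b / sinh b + cosh a / sinh a * cos T) / ((sinh a)^-1 * sin T) = P / Q.
  by rewrite /P /Q; field; rewrite !lt0r_neq0.
rewrite -acos_acot//; congr acos.
have s0 : 0 < Num.sqrt (P ^+ 2 + Q ^+ 2).
  by rewrite sqrtr_gt0 ltr_wpDl ?sqr_ge0// exprn_gt0.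
have -> : cosh a * A - cosh b = sinh a * P.
  transitivity ((cosh a ^+ 2 - 1) * cosh b + cosh a * sinh a * sinh b * cos T).
    by rewrite /A; ring.
  by rewrite -Ea /P; ring.
by field; rewrite !lt0r_neq0.
Qed.

End Coordinates.

(** * One-sided derivatives on the half-line *)

Section HalfLine.
Context {R : realType}.
Implicit Types (f : R -> R) (t l : R).

Lemma is_derive_halfline f t l :
  is_derive t 1 f l -> has_halfline_derivative f t l.
Proof.
move=> [df dl]; apply: cvg_within_filter.
have -> : (fun h => h^-1 * (f (t + h) - f t)) =
          (fun h => h^-1 *: ((f \o shift t) (h *: 1) - f t)).
  by apply/funext => h /=; rewrite /GRing.scale /= mulr1 (addrC h).
by rewrite -dl; exact: df.
Qed.

Lemma halfline_is_derive f t l : 0 < t ->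
  has_halfline_derivative f t l -> is_derive t 1 f l.
Proof.
move=> t0 df.
have cq : (fun h => h^-1 *: ((f \o shift t) (h *: 1) - f t)) @ 0^' --> l.
  have -> : (fun h => h^-1 *: ((f \o shift t) (h *: 1) - f t)) =
            (fun h => h^-1 * (f (t + h) - f t)).
    by apply/funext => h /=; rewrite /GRing.scale /= mulr1 (addrC h).
  apply/cvgrPdist_lt => e e0.
  have /cvgrPdist_lt/(_ _ e0) := df; rewrite near_withinE => near_e.
  near=> h; have : 0 <= t + h -> `|l - h^-1 * (f (t + h) - f t)| < e.
    by near: h.
  apply; have : `|h| < t by near: h; exact: dnbhs0_lt.
  by rewrite ltr_norml; lra.
split; first by apply/cvg_ex; exists l.
exact: cvg_lim cq.
Unshelve. all: by end_near. Qed.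

Lemma halfline_cvg0 f l :
  has_halfline_derivative f 0 l -> f t @[t --> 0^'+] --> f 0.
Proof.
move=> df.
have cq : (fun h => h^-1 * (f (0 + h) - f 0)) @ 0^'+ --> l.
  apply/cvgrPdist_lt => e e0.
  have /cvgrPdist_lt/(_ _ e0) := df; rewrite near_withinE => near_e.
  move: near_e; rewrite !near_withinE; apply: filterS => h hh h0.
  by apply: hh => /=; rewrite ?add0r ?(ltW h0)// gt_eqF.
have : (fun h => f 0 + h * (h^-1 * (f (0 + h) - f 0))) @ 0^'+ --> f 0 + 0 * l.
  apply: cvgD; first exact: cvg_cst.
  by apply: cvgM cq; apply: cvg_at_right_filter; exact: cvg_id.
rewrite mul0r addr0; apply: cvg_trans; apply: near_eq_cvg.
rewrite near_withinE; near=> h => h0.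
by rewrite mulrA divff ?gt_eqF// mul1r add0r addrC subrK.
Unshelve. all: by end_near. Qed.

End HalfLine.

(** * The combinatorial Ricci flow *)

Section RicciFlow.
Context {R : realType} {S : topologicalType} {V E F : choiceType}.
Context (D : cellular_decomposition R S V E F) (g : geometry).
Context (delta : R) (Theta : E -> R).
Hypothesis hdeg : finite_degrees D.
Hypothesis hdelta : 0 < delta.
Hypothesis hTheta : forall e, delta < Theta e < pi - delta.

Definition star (v : V) : seq (E * bool) :=
  finmap.enum_fset (fset_set (out_edges D v)).

(** The curvature in the coordinates, as a function on all of V -> R. *)
Definition ext_curvature (v : V) (x : V -> R) : R :=
  2 * pi - 2 * \sum_(d <- star v)
    ext_angle g (Theta d.1) (x v) (x (edge_end D d.1 (~~ d.2))).

Lemma sinTheta_gt0 e : 0 < sin (Theta e).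
Proof.
have d0 := hdelta; have /andP[h1 h2] := hTheta e.
by apply: sin_gt0_pi; apply/andP; split; lra.
Qed.

Lemma sinTheta_gt e : sin delta < sin (Theta e).
Proof.
have p0 := hdelta; have /andP[h1 h2] := hTheta e; have S0 := sinTheta_gt0 e.
have d0 : 0 < sin delta by apply: sin_gt0_pi; apply/andP; split; lra.
(* compare the squares of the cosines *)
have c1 : cos (Theta e) < cos delta.
  by rewrite ltr_cos// in_itv /=; apply/andP; split; lra.
have c2 : cos (pi - delta) < cos (Theta e).
  by rewrite ltr_cos// in_itv /=; apply/andP; split; lra.
have {}c2 : - cos delta < cos (Theta e).
  by move: c2; rewrite cosB cospi sinpi; lra.
have := cos2Dsin2 delta; have := cos2Dsin2 (Theta e); nra.
Qed.

Lemma curvatureE (r : V -> R) v : (forall w, 0 < r w) ->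
  curvature D g Theta r v = ext_curvature v (fun w => coord g (r w)).
Proof.
move=> r0; rewrite /curvature (fsbig_finite _ _ (hdeg v)) /ext_curvature /star.
by congr (_ - 2 * _); apply: eq_bigr => d _; rewrite inner_angleE// sinTheta_gt0.
Qed.

Definition star_lip v : R := \sum_(d <- star v) angle_lip_const (Theta d.1).

Lemma star_lip_ge0 v : 0 <= star_lip v.
Proof. by apply: sumr_ge0 => d _; rewrite angle_lip_const_ge0// sinTheta_gt0. Qed.

(** Raising the neighbours only increases the curvature, and raising the vertex
    itself decreases it at most at the rate 2 * star_lip. *)
Lemma ext_curvature_mono v (x y : V -> R) : (forall w, x w <= y w) ->
  2 * star_lip v * x v + ext_curvature v x <= 2 * star_lip v * y v + ext_curvature v y.
Proof.
move=> xy.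
suff : \sum_(d <- star v) ext_angle g (Theta d.1) (y v) (y (edge_end D d.1 (~~ d.2)))
   <= \sum_(d <- star v) ext_angle g (Theta d.1) (x v) (x (edge_end D d.1 (~~ d.2)))
      + star_lip v * (y v - x v) by rewrite /ext_curvature; lra.
rewrite /star_lip mulr_suml -big_split /=; apply: ler_sum => d _.
have S0 := sinTheta_gt0 d.1.
have := ext_angle_decr g _ (y v) _ _ S0 (xy (edge_end D d.1 (~~ d.2))).
have := ext_angle_lip g _ _ _ (x (edge_end D d.1 (~~ d.2))) S0 (xy v).
lra.
Qed.

Lemma ext_curvature_shift v (x : V -> R) (c : R) : 0 <= c ->
  ext_curvature v (fun w => x w + c) <= ext_curvature v x.
Proof.
move=> c0; rewrite /ext_curvature lerB// ler_wpM2l//; apply: ler_sum => d _.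
by apply: ext_angle_diagonal => //; exact: sinTheta_gt0.
Qed.

(** Keeps hyperbolic coordinates away from 0: a vertex with small coordinate has
    cone angle at most 2 pi. *)
Lemma ext_curvature_floor v : g = Hyperbolic ->
  exists2 m : R, 0 < m & forall x, x v <= m -> 0 <= ext_curvature v x.
Proof.
move=> gH; have l0 := star_lip_ge0 v.
have p0 := @pi_gt0 R.
(* star_lip v vanishes at an isolated vertex, hence the + 1 *)
exists (pi / (star_lip v + 1)) => [|x xm].
  by rewrite divr_gt0// ltr_wpDl.
have m0 : 0 <= pi / (star_lip v + 1) by rewrite divr_ge0// ?ltW// ltr_wpDl.
have : star_lip v * (pi / (star_lip v + 1)) <= pi.
  by rewrite mulrA ler_pdivrMr ?ltr_wpDl//; nra.
suff : \sum_(d <- star v) ext_angle g (Theta d.1) (x v) (x (edge_end D d.1 (~~ d.2)))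
   <= star_lip v * (pi / (star_lip v + 1)) by rewrite /ext_curvature; lra.
rewrite {2}/star_lip mulr_suml; apply: ler_sum => d _.
have S0 := sinTheta_gt0 d.1.
rewrite gH; apply: le_trans (ext_angle_ideal _ _ (x (edge_end D d.1 (~~ d.2))) S0 m0).
exact: ext_angle_incr.
Qed.

(** The factor is uniform over the vertices as soon as the curvature of y is
    bounded below.  Without edges nothing bounds delta by pi and sin delta may be
    negative, hence the absolute value. *)
Lemma ext_curvature_compare v (x y : V -> R) (C : R) : 0 <= C -> y v <= x v ->
  (forall w, x w <= y w + C) ->
  ext_curvature v x - ext_curvature v y <= (2 * pi - ext_curvature v y) / `|sin delta| * C.
Proof.
move=> C0 yx xyC.
have -> : 2 * pi - ext_curvature v y = 2 * \sum_(d <- star v)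
    ext_angle g (Theta d.1) (y v) (y (edge_end D d.1 (~~ d.2))).
  by rewrite /ext_curvature; ring.
suff : \sum_(d <- star v) ext_angle g (Theta d.1) (y v) (y (edge_end D d.1 (~~ d.2)))
  <= \sum_(d <- star v) ext_angle g (Theta d.1) (x v) (x (edge_end D d.1 (~~ d.2)))
    + (\sum_(d <- star v) ext_angle g (Theta d.1) (y v) (y (edge_end D d.1 (~~ d.2))))
      * (C / `|sin delta|) by rewrite /ext_curvature; lra.
rewrite mulr_suml -big_split /=; apply: ler_sum => d _.
have S0 := sinTheta_gt0 d.1; have Sd := sinTheta_gt d.1.
have d0 : 0 < sin delta.
  by have p0 := hdelta; have /andP[? ?] := hTheta d.1; apply: sin_gt0_pi; apply/andP; split; lra.
set w := edge_end D d.1 _.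
have h1 := ext_angle_incr g _ _ _ (x w) S0 yx.
have h2 := ext_angle_decr g _ (y v) _ _ S0 (xyC w).
have h3 := ext_angle_log_lip g _ (y v) (y w) _ S0 C0.
have a0 := ext_angle_ge0 g (Theta d.1) (y v) (y w).
have : ext_angle g (Theta d.1) (y v) (y w) / sin (Theta d.1) * C <=
       ext_angle g (Theta d.1) (y v) (y w) * (C / `|sin delta|).
  rewrite -mulrA ler_wpM2l// mulrC ler_wpM2l// gtr0_norm// lef_pV2 ?posrE//; exact: ltW.
lra.
Qed.

Context (r0 : V -> R).
Hypothesis hr0 : forall v, 0 < r0 v.

Lemma flow_exists (M : R) : (forall v, `|curvature D g Theta r0 v| <= M) ->
  exists r : V -> R -> R,
    bounded_curvature_class D g Theta r /\ ricci_flow_solution D g Theta r0 r.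
Proof.
move=> hM; pose x0 v := coord g (r0 v).
have bK v : `|ext_curvature v x0| <= M by rewrite -curvatureE.
have L0 v : 0 <= 2 * star_lip v by rewrite mulr_ge0// star_lip_ge0.
have [x [xi hx]] := quasimonotone_flow _ _ _ _ L0 ext_curvature_mono ext_curvature_shift bK.
have sx v (t : R) : 0 <= t -> 0 < gsinh g (x v t).
  move=> t0; have [gE|gH] : g = Euclidean \/ g = Hyperbolic by case: (g); [left|right].
    by rewrite gE; exact: expR_gt0.
  have [m m0 hm] := ext_curvature_floor v gH.
  have x00 : 0 < x0 v by rewrite /x0 gH; exact: dual_gt0.
  (* K_v >= 0 below m, so x_v cannot go below the smaller of m and x_v(0) *)
  have mx0 : 0 < Num.min m (x0 v) by rewrite lt_min m0.
  rewrite gH /gsinh sinh_gt0; apply: lt_le_trans mx0 _.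
  rewrite -lerN2.
  apply: (@barrier_closed R (fun t => - x v t) (fun t => - ext_curvature v (x ^~ t))) t0.
  - by rewrite xi lerN2 ge_min lexx orbT.
  - by move=> u u0; apply: der_opp; exact: (hx v u u0).1.
  - move=> u u0; rewrite ltrN2 lt_min => /andP[h _]; rewrite oppr_le0.
    by apply: hm; exact: ltW.
pose r v t := radius g (x v t).
have Kr v (t : R) : 0 <= t -> curvature D g Theta (r ^~ t) v = ext_curvature v (x ^~ t).
  move=> t0; rewrite curvatureE; last by move=> w; exact/radius_gt0/sx.
  by congr ext_curvature; apply/funext => w; rewrite /r radiusK// sx.
exists r; split; split.
- by move=> v t t0; exact/radius_gt0/sx.
- by exists M => v t t0; rewrite Kr//; exact: (hx v t t0).2.
- by move=> v; rewrite /r xi /x0 coordK.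
- move=> v t t0; apply: is_derive_halfline; rewrite Kr//.
  exact: (der_radius g _ _ _ (sx v t t0) (hx v t t0).1).
Qed.

Lemma coord_flow (r : V -> R -> R) v (t : R) :
  bounded_curvature_class D g Theta r -> ricci_flow_solution D g Theta r0 r ->
  0 < t -> is_derive t 1 (fun u => coord g (r v u))
                     (curvature D g Theta (r ^~ t) v).
Proof.
move=> [rp _] [_ dr] t0; have rt := rp v t (ltW t0).
have d := der_coord g _ _ _ rt (halfline_is_derive _ _ _ t0 (dr v t (ltW t0))).
have s0 : flow_scale g (r v t) != 0.
  by apply: lt0r_neq0; case: (g) => //=; exact: sinh_gt0P.
by apply: (der_eq _ _ _ _ d); field.
Qed.

Lemma flow_le (r r' : V -> R -> R) :
  bounded_curvature_class D g Theta r -> ricci_flow_solution D g Theta r0 r ->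
  bounded_curvature_class D g Theta r' -> ricci_flow_solution D g Theta r0 r' ->
  forall v (t : R), 0 <= t -> coord g (r v t) <= coord g (r' v t).
Proof.
move=> br sr br' sr' v t t0.
have [rp [M hM]] := br; have [rp' [M' hM']] := br'.
have [ri dr] := sr; have [ri' dr'] := sr'.
have M0 : 0 <= M by exact: le_trans (hM v 0 (lexx 0)).
have M0' : 0 <= M' by exact: le_trans (hM' v 0 (lexx 0)).
have pi0 := @pi_gt0 R.
pose z w u := coord g (r w u) - coord g (r' w u).
pose dz w u := curvature D g Theta (r ^~ u) w - curvature D g Theta (r' ^~ u) w.
have hz w (u : R) : 0 < u -> is_derive u 1 (z w) (dz w u).
  by move=> u0; apply: der_sub; exact: coord_flow.
have z0 w : z w 0 = 0 by rewrite /z ri ri' subrr.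
have cc (f : R -> R) : 0 < f 0 -> f u @[u --> 0^'+] --> f 0 ->
    coord g (f u) @[u --> 0^'+] --> coord g (f 0).
  move=> f0 cf; apply: (cvg_comp f (coord g) cf).
  exact: is_derive_continuous (der_coord g id _ _ f0 (der_id (f 0))).
have cz w : z w u @[u --> 0^'+] --> 0.
  rewrite -[X in _ --> X](z0 w); apply: cvgB; apply: cc.
  - exact: rp.
  - exact: halfline_cvg0 (dr w 0 (lexx 0)).
  - exact: rp'.
  - exact: halfline_cvg0 (dr' w 0 (lexx 0)).
have zB w (u : R) : 0 <= u -> z w u <= (M + M') * u.
  move=> u0; rewrite -subr_le0.
  apply: (@barrier R (fun u => z w u - (M + M') * u) (fun u => dz w u - (M + M'))) u0.
  - by rewrite z0 mulr0 subrr.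
  - rewrite z0 mulr0 subr0.
    rewrite -[X in _ --> X]subr0; apply: cvgB; first exact: cz.
    rewrite -[X in _ --> X](mulr0 (M + M')); apply: cvgM; first exact: cvg_cst.
    exact/cvg_at_right_filter/cvg_id.
  - by move=> a a0; have hza := hz w a a0; derive_to; ring.
  - move=> a a0 _; move: (hM w a (ltW a0)) (hM' w a (ltW a0)).
    rewrite /dz subr_le0 => k k'; apply: le_trans (ler_norm _) _.
    exact: le_trans (ler_normB _ _) (lerD k k').
rewrite -subr_le0.
apply: (@sup_comparison R V z dz (M + M') (1 + (2 * pi + M') / `|sin delta|)) t0 => //.
- exact: addr_ge0.
- by rewrite lerDl divr_ge0 ?normr_ge0//; lra.
- move=> i u C u0 C0 zC zi.
  (* C is now a bound on z at time u, and M' controls the angles at i *)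
  have rpu w' : 0 < r w' u by exact/rp/ltW.
  have rpu' w' : 0 < r' w' u by exact/rp'/ltW.
  rewrite /dz !curvatureE//.
  apply: le_trans (ext_curvature_compare i _ _ C C0 _ _) _.
  + by apply: ltW; rewrite -subr_gt0.
  + by move=> j; rewrite -lerBlDl; exact: zC.
  apply: ler_wpM2r => //; rewrite -subr_ge0.
  have := hM' i u (ltW u0); rewrite curvatureE// ler_norml => /andP[h _].
  have -> : 1 + (2 * pi + M') / `|sin delta| - (2 * pi -
    ext_curvature i (fun w => coord g (r' w u))) / `|sin delta| =
    1 + (M' + ext_curvature i (fun w => coord g (r' w u))) / `|sin delta| by ring.
  by rewrite addr_ge0// divr_ge0 ?normr_ge0//; lra.
Qed.

End RicciFlow.

Theorem theorem1p5 (R : realType) (S : topologicalType) (V E F : choiceType)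
    (D : cellular_decomposition R S V E F) (g : geometry)
    (delta : R) (Theta : E -> R) (r0 : V -> R)
    (hS : surface R S) (hSnc : noncompact S)
    (hinf : infinite_decomposition D)
    (hdeg : finite_degrees D) (hconn : connected_skeleton D)
    (hdelta : 0 < delta)
    (hTheta : forall e, delta < Theta e < pi - delta)
    (hC1 : condition_C1 D Theta)
    (hr0 : forall v, 0 < r0 v)
    (hK0 : exists M : R, forall v, `|curvature D g Theta r0 v| <= M) :
  (exists r : V -> R -> R,
     bounded_curvature_class D g Theta r /\
     ricci_flow_solution D g Theta r0 r) /\
  (forall r r' : V -> R -> R,
     bounded_curvature_class D g Theta r ->
     ricci_flow_solution D g Theta r0 r ->
     bounded_curvature_class D g Theta r' ->
     ricci_flow_solution D g Theta r0 r' ->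
     forall v t, 0 <= t -> r v t = r' v t).
Proof.
split.
  have [M hM] := hK0; exact: (flow_exists _ _ _ _ hdeg hdelta hTheta _ hr0 _ hM).
move=> r r' br sr br' sr' v t t0.
have le12 := flow_le _ _ _ _ hdeg hdelta hTheta _ _ _ br sr br' sr' v t t0.
have le21 := flow_le _ _ _ _ hdeg hdelta hTheta _ _ _ br' sr' br sr v t t0.
rewrite -(coordK g _ (br.1 v t t0)) -(coordK g _ (br'.1 v t t0)).
by congr radius; apply/eqP; rewrite eq_le le12.
Qed.
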